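(* Let $d\ge1$, $\sigma>0$, let $P$ be a distribution on $\mathbb{R}^d$, and let $S\sim P$, $Y=S+Z$ with $Z\sim\mathcal{N}_\sigma$ independent of $S$. If $I_{\chi^2}(S;Y)=\infty$, then, as $n\to\infty$, $$\mathbb{E}_{P^{\otimes n}}\,\mathsf{D}_{\mathsf{KL}}\big(\hat P_{S^n}\ast\mathcal{N}_\sigma\,\big\|\,P\ast\mathcal{N}_\sigma\big)=\omega\left(\frac1n\right).$$
   Context: $\mathcal{N}_\sigma=\mathcal{N}(0,\sigma^2\mathrm{I}_d)$; $S^n=(S_1,\dots,S_n)\sim P^{\otimes n}$; $\hat P_{S^n}=\frac1n\sum_{i=1}^n\delta_{S_i}$; $\ast$ is convolution of measures. $\mathsf{D}_{\mathsf{KL}}(\mu\|\nu)=\int\log\big(\frac{d\mu}{d\nu}\big)d\mu$, $\chi^2(\mu\|\nu)=\int\big(\frac{d\mu}{d\nu}-1\big)^2d\nu$, and $I_{\chi^2}(S;Y)=\chi^2(P_{S,Y}\|P_S\otimes P_Y)$, where $P_{S,Y}$ is the joint law of $(S,Y)$ and $P_S,P_Y$ its marginals. $a_n=\omega(1/n)$ means $n\,a_n\to\infty$ as $n\to\infty$. *)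

(* Defs.v *)
From HB Require Import structures.
From mathcomp Require Import all_boot all_order all_algebra.
From mathcomp Require Import all_classical all_reals all_analysis.

(* MathComp-Analysis.  R^d is the type d.-tuple R with its product (= Borel)
   sigma-algebra; divergences and expectations take values in \bar R. *)

Set Implicit Arguments.
Unset Strict Implicit.
Unset Printing Implicit Defensive.
Import Order.TTheory GRing.Theory Num.Theory.
Import numFieldNormedType.Exports.

Local Open Scope classical_set_scope.
Local Open Scope ring_scope.

Section pairs.
Context d d1 d2 (T : measurableType d) (T1 : measurableType d1)
  (T2 : measurableType d2).

Definition pair_rv (X : {mfun T >-> T1}) (Y : {mfun T >-> T2}) (w : T)
  : T1 * T2 := (X w, Y w).

Variables (X : {mfun T >-> T1}) (Y : {mfun T >-> T2}).

Lemma measurable_pair_rv : measurable_fun setT (pair_rv X Y).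
Proof. by apply: measurable_fun_pair. Qed.

HB.instance Definition _ :=
  isMeasurableFun.Build _ _ _ _ (pair_rv X Y) measurable_pair_rv.

End pairs.

Section random_variables.
Context dO (Omega : measurableType dO) (R : realType)
  (Pr : probability Omega R).
Local Open Scope ereal_scope.

(* Measures are compared on measurable sets only: their values elsewhere are
   not meaningful. *)
Definition has_law d (T : measurableType d) (X : {RV Pr >-> T})
    (mu : {measure set T -> \bar R}) : Prop :=
  forall A, measurable A -> distribution Pr X A = mu A.

Definition independent_rv d1 d2 (T1 : measurableType d1)
    (T2 : measurableType d2) (X : {RV Pr >-> T1}) (Y : {RV Pr >-> T2}) : Prop :=
  forall A B, measurable A -> measurable B ->
    Pr (X @^-1` A `&` Y @^-1` B) = Pr (X @^-1` A) * Pr (Y @^-1` B).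

End random_variables.

Section divergences.
Context d (T : measurableType d) (R : realType).
Local Open Scope ereal_scope.
Local Open Scope charge_scope.

Definition density (mu nu : {finite_measure set T -> \bar R}) : T -> \bar R :=
  'd (charge_of_finite_measure mu) '/d nu.

(* lne is the logarithm on \bar R, with lne 0 = -oo.  Both divergences are +oo
   when mu is not absolutely continuous with respect to nu. *)
Definition kl_div (mu nu : {finite_measure set T -> \bar R}) : \bar R :=
  if `[< mu `<< nu >] then \int[mu]_x lne (density mu nu x) else +oo.

Definition chi2_div (mu nu : {finite_measure set T -> \bar R}) : \bar R :=
  if `[< mu `<< nu >] then \int[nu]_x (density mu nu x - 1) ^+ 2 else +oo.

End divergences.

Definition chi2_info dO (Omega : measurableType dO) (R : realType)
    (Pr : probability Omega R) d1 d2 (T1 : measurableType d1)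
    (T2 : measurableType d2) (X : {RV Pr >-> T1}) (Y : {RV Pr >-> T2})
  : \bar R :=
  chi2_div (distribution Pr (pair_rv X Y))
           (distribution Pr X \x distribution Pr Y
             : probability (T1 * T2)%type R)%E.

Section power_of_a_law.
Context d (T : measurableType d) (R : realType).

Definition tuple_cons n (z : T * n.-tuple T) : n.+1.-tuple T :=
  [tuple of z.1 :: z.2].

Lemma measurable_tuple_cons n : measurable_fun setT (@tuple_cons n).
Proof. by apply: measurable_cons. Qed.

HB.instance Definition _ n :=
  isMeasurableFun.Build _ _ _ _ (@tuple_cons n) (@measurable_tuple_cons n).

Variable P : probability T R.

(* The n-fold product law P^{(x) n} on n.-tuple T; see power_law_box. *)
Fixpoint power_law n : probability (n.-tuple T) R :=
  if n is n'.+1 then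
    distribution (P \x power_law n' : probability (T * n'.-tuple T)%type R)%E
      (@tuple_cons n')
  else \d_[tuple].

Lemma measurable_box n (A : 'I_n -> set T) : (forall i, measurable (A i)) ->
  measurable [set s : n.-tuple T | forall i, A i (tnth s i)].
Proof.
move=> mA; rewrite (_ : [set _ | _] =
    \bigcap_(i in [set: 'I_n]) ((@tnth n T ^~ i) @^-1` A i)); last first.
  by apply/seteqP; split=> [s h i _|s h i]; exact: h.
apply: fin_bigcap_measurable; first exact: finite_finset.
by move=> i _; rewrite -[X in measurable X]setTI; exact: measurable_tnth.
Qed.

Lemma power_law_box n (A : 'I_n -> set T) : (forall i, measurable (A i)) ->
  power_law n [set s | forall i, A i (tnth s i)] = (\prod_(i < n) P (A i))%E.
Proof.
elim: n A => [|n IHn] A mA.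
  rewrite big_ord0 /= diracE mem_set// => -[].
  by case.
rewrite big_ord_recl -IHn//= -product_measure1E//; last first.
  exact: (measurable_box (fun i => mA _)).
rewrite /distribution /pushforward; congr (_ _).
apply/seteqP; split=> [[x t] h|[x t] [hx ht] i] /=.
  split=> [|i] /=; first exact: (h ord0).
  by have := h (lift ord0 i); rewrite tnthS.
by case: (unliftP ord0 i) => [j|] ->; rewrite ?tnthS.
Qed.

End power_of_a_law.

Section empirical_measure.
Context d (T : measurableType d) (R : realType) (n : nat).
Local Open Scope ereal_scope.
Variable s : n.-tuple T.

(* For n = 0 this is the zero measure (0^-1 = 0). *)
Definition empirical (A : set T) : \bar R :=
  (n%:R^-1 : R)%R%:E * \sum_(i < n) \d_(tnth s i) A.

Let empiricalE : empirical =
  mscale ((n%:R^-1 : R)%:nng)%R (msum (fun k => \d_(nth point s k)) n).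
Proof.
apply/funext => A; rewrite /mscale /msum /empirical/=; congr (_ * _).
by apply: eq_bigr => i _; rewrite (tnth_nth point).
Qed.

Let empirical0 : empirical set0 = 0.
Proof. by rewrite empiricalE measure0. Qed.

Let empirical_ge0 A : 0 <= empirical A.
Proof. by rewrite empiricalE measure_ge0. Qed.

Let empirical_sigma_additive : semi_sigma_additive empirical.
Proof. by rewrite empiricalE; exact: measure_semi_sigma_additive. Qed.

HB.instance Definition _ := isMeasure.Build _ _ _ empirical
  empirical0 empirical_ge0 empirical_sigma_additive.

Let empirical_finite : fin_num_fun empirical.
Proof.
move=> A mA; rewrite /empirical fin_numM// sum_fin_num.
by apply/allP => _ /mapP[i _ ->]; rewrite diracE.
Qed.

HB.instance Definition _ := Measure_isFinite.Build _ _ _ empirical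
  empirical_finite.

End empirical_measure.

Section convolution.
Context (R : realType) (d : nat).
Local Open Scope ereal_scope.

Definition addt (x y : d.-tuple R) : d.-tuple R :=
  [tuple (tnth x i + tnth y i)%R | i < d].

Definition addt_pair (z : d.-tuple R * d.-tuple R) := addt z.1 z.2.

Lemma measurable_addt_pair : measurable_fun setT addt_pair.
Proof.
apply/measurable_fun_tnthP => i.
rewrite (_ : _ \o _ = fun z => (tnth z.1 i + tnth z.2 i)%R); last first.
  by apply/funext => z; rewrite /= tnth_mktuple.
apply: measurable_realfun.measurable_funD;
  exact: measurableT_comp (measurable_tnth i) _.
Qed.

HB.instance Definition _ :=
  isMeasurableFun.Build _ _ _ _ addt_pair measurable_addt_pair.

Variables mu nu : {finite_measure set (d.-tuple R) -> \bar R}.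

Definition convolution : set (d.-tuple R) -> \bar R :=
  pushforward (mu \x nu) addt_pair.

Let convolution0 : convolution set0 = 0.
Proof. exact: measure0. Qed.

Let convolution_ge0 A : 0 <= convolution A.
Proof. exact: measure_ge0. Qed.

Let convolution_sigma_additive : semi_sigma_additive convolution.
Proof. exact: measure_semi_sigma_additive. Qed.

HB.instance Definition _ := isMeasure.Build _ _ _ convolution
  convolution0 convolution_ge0 convolution_sigma_additive.

Let convolution_finite : fin_num_fun convolution.
Proof.
move=> A mA; rewrite ge0_fin_numE//.
apply: (@le_lt_trans _ _ (convolution setT)).
  by apply: le_measure; rewrite ?inE//.
rewrite /convolution/pushforward preimage_setT -setXTT product_measure1E//.
by rewrite ltey_eq fin_numM ?fin_num_measure.
Qed.

HB.instance Definition _ := Measure_isFinite.Build _ _ _ convolution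
  convolution_finite.

End convolution.

Section gaussian.
Context (R : realType).

(* The library's normal law lives on measurableTypeR R, a copy of R with the
   same sigma-algebra. *)
Definition from_measurableTypeR (x : measurableTypeR R) : R := x.

Lemma measurable_from_measurableTypeR : measurable_fun setT from_measurableTypeR.
Proof. exact: (@measurable_id _ _ setT). Qed.

HB.instance Definition _ := isMeasurableFun.Build _ _ _ _ from_measurableTypeR
  measurable_from_measurableTypeR.

Definition normal_law (m sigma : R) : probability R R :=
  distribution (normal_prob m sigma) from_measurableTypeR.

(* N(0, sigma^2 I_d): independent N(0, sigma^2) coordinates; normal_law takes
   the standard deviation. *)
Definition gaussian (d : nat) (sigma : R) : probability (d.-tuple R) R :=
  power_law (normal_law 0 sigma) d.

End gaussian.

(* Main.v *)
Require Import Defs.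
From HB Require Import structures.
From mathcomp Require Import all_boot all_order all_algebra.
From mathcomp Require Import all_classical all_reals all_analysis.
From mathcomp Require Import ring lra.

Set Implicit Arguments.
Unset Strict Implicit.
Unset Printing Implicit Defensive.
Import Order.TTheory GRing.Theory Num.Theory.
Import numFieldNormedType.Exports.
Import measurable_realfun.

Local Open Scope classical_set_scope.
Local Open Scope ring_scope.

(** Write [Q = P * N_sigma] for the output law, [r (s, y)] for the likelihood
    ratio of [N(s, sigma^2 I)] to [Q] at [y], and [r_n (y)] for the mean of
    [r (S_i, y)] over the sample.  Then [r_n] is the density of the smoothed
    empirical measure with respect to [Q], each [r (S_i, y)] has mean 1, and the
    chi-square information is the integral over [Q] of the variance [V (y)] of
    [r (S_1, y)].

    Relative entropy dominates the squared Hellinger distance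
    ([hellinger_le_kl_div]), so it is enough to bound from below the expectation
    of [(sqrt (r_n (y)) - 1) ^ 2], integrated over [y].  For fixed [y] it behaves
    like [V (y) / (4 n)] for large [n].  An explicit lower bound holds as soon as
    the ratio is bounded: when [r (s, y) <= B (y) <= n] for every [s], the
    inequality
    [(sqrt t - 1) ^ 2 >= (t - 1) ^ 2 / 4 - (t - 1) ^ 3 / 8] and the first three
    moments of a sum of independent centered variables show that it is at least
    [V (y) / (8 n)] ([variance_le_hellinger_mean]).

    For Gaussian noise such a finite [B (y)] exists at every [y], because the
    Gaussian density is bounded.  Restricting the Hellinger integral to the
    region where [B <= n] therefore gives
    [n * E KL >= 1/8 * int_(B <= n) V dQ] ([truncated_chi2_le_kl_div]).  As [n]
    grows the region exhausts the space, and by monotone convergence the right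
    side tends to an eighth of the chi-square information, that is to infinity
    ([cvg_kl_div_pinfty]).

    All densities are taken with respect to the centered Gaussian law; the
    density of a translate is the Cameron-Martin formula
    ([integral_gaussian_shift]).  It yields at the same time the density of the
    smoothed empirical measure ([convolution_empiricalE]) and that of the joint
    law of input and output ([joint_density]). *)

(** * Elementary inequalities *)

Section inequalities.
Context {R : realType}.
Implicit Types t : R.

(** With [s = sqrt t], the right side minus the left side is
    [(s - 1) ^ 4 * (s ^ 2 + 4 * s + 5) / 8].  A cubic minorant is what makes the
    method of moments applicable to the mean of an i.i.d. sample; the cubic
    term will be of lower order there. *)
Lemma sqrB1_sqrt_ge t : 0 <= t ->
  4^-1 * (t - 1) ^+ 2 - 8^-1 * (t - 1) ^+ 3 <= (Num.sqrt t - 1) ^+ 2.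
Proof.
move=> t0; have s0 := sqrtr_ge0 t.
rewrite -{1 2}(sqr_sqrtr t0); set s := Num.sqrt t in s0 *.
rewrite -subr_ge0 (_ : _ - _ = 8^-1 * ((s - 1) ^+ 4 * (s ^+ 2 + 4 * s + 5))).
  have s40 : 0 <= (s - 1) ^+ 4 by rewrite exprn_even_ge0.
  have : 0 <= s ^+ 2 + 4 * s + 5 by nra.
  by move=> h; apply: mulr_ge0 => //; exact: mulr_ge0.
by field.
Qed.

(** This is [ln u <= u - 1] at [u = 1 / sqrt t]. *)
Lemma ln_ge_inv_sqrt t : 0 < t -> 2 - 2 * t `^ (- 2^-1) <= ln t.
Proof.
move=> t0; have p0 : 0 < t `^ (- 2^-1) by exact: powR_gt0.
have p1 : -1 < t `^ (- 2^-1) - 1 by lra.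
have := le_ln1Dx p1; rewrite (addrC 1) subrK ln_powR; lra.
Qed.

Lemma mulr_inv_sqrt t : 0 <= t -> t `^ (- 2^-1) * t = Num.sqrt t.
Proof.
move=> t0; rewrite -powR12_sqrt//.
have [->|tn0] := eqVneq t 0; first by rewrite mulr0 powR0.
rewrite -{2}(powRr1 t0) -powRD ?tn0 ?implybT//.
by congr (_ `^ _); field.
Qed.

End inequalities.

(** * Integrals and densities *)

Lemma measurable_lne (R : realType) : measurable_fun [set: \bar R] (@lne R).
Proof.
rewrite (_ : @lne R = fun x => if (x <= 0)%E then -oo%E else
   if x == +oo%E then +oo%E else (ln (fine x))%:E); last first.
  by apply/funext => -[r| |]//=; rewrite leNye.
apply: measurable_fun_ifT => //=.
  by apply: measurable_fun_lee => //.
apply: measurable_fun_ifT => //=.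
  by apply: measurable_fun_eqe => //.
apply/measurable_EFinP; apply: measurableT_comp; first exact: measurable_ln.
exact: fine_measurable.
Qed.

Lemma measurable_sqrt (R : realType) : measurable_fun [set: R] (@Num.sqrt R).
Proof. apply: continuous_measurable_fun => x; exact: sqrt_continuous. Qed.

Section integration.
Context d (T : measurableType d) (R : realType).
Local Open Scope ereal_scope.

(** The integral of a nonnegative function is a supremum over the simple
    functions below it, so monotonicity needs no measurability of the larger
    function.  It is used with the relative entropy, as a function of the
    sample, on the right. *)
Lemma ge0_le_integral_nonmeasurable (mu : {measure set T -> \bar R})
    (f g : T -> \bar R) : measurable_fun setT f ->
  (forall x, 0 <= f x) -> (forall x, f x <= g x) ->
  \int[mu]_x f x <= \int[mu]_x g x.
Proof.
move=> mf f0 fg; have g0 x : 0 <= g x := le_trans (f0 x) (fg x).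
rewrite ge0_integralTE// [leRHS]ge0_integralTE//.
apply: ub_ereal_sup => _ [h hf <-]; apply: ereal_sup_ubound.
by exists h => // x; apply: le_trans (fg x).
Qed.

(** The larger function need not be integrable: its negative part is, being
    dominated by that of [f], so its integral cannot be [+oo - +oo]. *)
Lemma ae_le_integral_minorant (mu : {measure set T -> \bar R})
    (f g : T -> \bar R) :
  mu.-integrable setT f -> measurable_fun setT g ->
  {ae mu, forall x, f x <= g x} -> \int[mu]_x f x <= \int[mu]_x g x.
Proof.
move=> intf mg fg; have mf := measurable_int _ intf.
rewrite integralE [leRHS]integralE leeB//.
- apply: ae_ge0_le_integral => //; try exact: measurable_funepos.
  apply: filterS fg => x fgx _.
  by rewrite !funeposE ge_max le_max fgx/= le_max lexx orbT.
- apply: ae_ge0_le_integral => //; try exact: measurable_funeneg.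
  apply: filterS fg => x fgx _.
  by rewrite !funenegE ge_max le_max leeN2 fgx/= le_max lexx orbT.
Qed.

Lemma bounded_integrable (mu : {finite_measure set T -> \bar R})
    (f : T -> R) C :
  measurable_fun setT f -> (forall x, `|f x| <= C)%R ->
  mu.-integrable setT (EFin \o f).
Proof.
move=> mf fC; apply: measurable_bounded_integrable => //.
  by rewrite ltey_eq fin_num_measure.
exists C; split; first exact: num_real.
by move=> M CM x _ /=; rewrite (le_trans (fC x))// ltW.
Qed.

Section change_of_density.
Variables (mu : {finite_measure set T -> \bar R})
  (nu : {sigma_finite_measure set T -> \bar R}) (f : T -> \bar R).
Hypothesis mf : measurable_fun setT f.
Hypothesis muE : forall A, measurable A -> mu A = \int[nu]_(x in A) f x.

Lemma density_dominates : mu `<< nu.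
Proof.
apply/null_content_dominatesP => A mA nuA0.
rewrite muE// null_set_integral//.
exact: measurable_funTS.
Qed.

Lemma ge0_integral_density D g : measurable D -> measurable_fun D g ->
  (forall x, 0 <= g x) ->
  \int[mu]_(x in D) g x = \int[nu]_(x in D) (g x * f x).
Proof.
move=> mD mg g0; have munu := density_dominates.
have RNint := Radon_Nikodym_SigmaFinite.f_integrable munu.
rewrite -(Radon_Nikodym_SigmaFinite.change_of_variables munu)//.
apply: ae_eq_integral => //.
- apply: emeasurable_funM => //.
  exact/measurable_funTS/(measurable_int _ RNint).
- by apply: emeasurable_funM => //; exact: measurable_funTS.
- apply: ae_eqe_mul2l; apply: integral_ae_eq => //.
  + exact: integrableS RNint.
  + exact: measurable_funTS.
  + move=> A _ mA; rewrite -Radon_Nikodym_SigmaFinite.f_integral//.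
    exact: muE.
Qed.

End change_of_density.

Lemma density_ae_eq (mu nu : {finite_measure set T -> \bar R})
    (f : T -> \bar R) :
  measurable_fun setT f ->
  (forall A, measurable A -> mu A = \int[nu]_(x in A) f x) ->
  ae_eq nu setT (density mu nu) f.
Proof.
move=> mf muE; have munu := density_dominates mf muE.
apply: integral_ae_eq => //; first exact: Radon_Nikodym_integrable.
move=> A _ mA; rewrite -Radon_Nikodym_integral//.
exact: muE.
Qed.

End integration.

(** * Squared Hellinger distance and relative entropy *)

Section hellinger.
Context d (T : measurableType d) (R : realType).
Variables (mu nu : {finite_measure set T -> \bar R}) (f : T -> R).
Hypotheses (mf : measurable_fun setT f) (f0 : forall x, 0 <= f x).
Hypothesis muE :
  forall A, measurable A -> mu A = (\int[nu]_(x in A) (f x)%:E)%E.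
Hypotheses (mu1 : mu setT = 1%E) (nu1 : nu setT = 1%E).
Local Open Scope ereal_scope.

Let meEf : measurable_fun setT (EFin \o f).
Proof. exact/measurable_EFinP. Qed.

Let intf1 : \int[nu]_x (f x)%:E = 1.
Proof. by rewrite -mu1 muE. Qed.

Let integrable_f : nu.-integrable setT (EFin \o f).
Proof.
apply/integrableP; split => //.
by under eq_integral do rewrite /= ger0_norm//; rewrite intf1 ltry.
Qed.

Let msqrt : measurable_fun setT (fun x => Num.sqrt (f x)).
Proof. exact: measurableT_comp (@measurable_sqrt R) mf. Qed.

Let integrable_sqrt : nu.-integrable setT (fun x => (Num.sqrt (f x))%:E).
Proof.
apply: (@le_integrable _ _ _ _ _ _ _ (fun x => (1 + f x)%:E)) => //.
- exact/measurable_EFinP.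
- move=> x _; rewrite lee_fin !ger0_norm ?sqrtr_ge0 ?addr_ge0//.
  by have := sqrtr_ge0 (f x); have := sqr_sqrtr (f0 x); nra.
- rewrite (_ : (fun _ => _) = cst 1 \+ (EFin \o f)); last exact/funext.
  by apply: integrableD => //; exact: finite_measure_integrable_cst.
Qed.

Let mpow : measurable_fun setT (fun x => f x `^ (- 2^-1))%R.
Proof. exact: measurableT_comp (measurable_powR _) mf. Qed.

Let int_pow : \int[mu]_x (f x `^ (- 2^-1))%:E = \int[nu]_x (Num.sqrt (f x))%:E.
Proof.
rewrite (ge0_integral_density meEf muE)//.
- by apply: eq_integral => x _; rewrite -EFinM mulr_inv_sqrt.
- exact/measurable_EFinP.
- by move=> x; rewrite lee_fin powR_ge0.
Qed.

Let integrable_pow : mu.-integrable setT (fun x => (f x `^ (- 2^-1))%:E).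
Proof.
apply/integrableP; split; first exact/measurable_EFinP.
under eq_integral do rewrite /= ger0_norm ?powR_ge0//.
rewrite int_pow; have /integrableP[_] := integrable_sqrt.
by under eq_integral do rewrite /= ger0_norm ?sqrtr_ge0//.
Qed.

Let hellinger_eq : \int[nu]_x ((Num.sqrt (f x) - 1) ^+ 2)%:E =
  2 - 2%:E * \int[nu]_x (Num.sqrt (f x))%:E.
Proof.
under eq_integral => x _.
  rewrite (_ : _%:E = (1 + f x)%:E - 2%:E * (Num.sqrt (f x))%:E); last first.
    rewrite -EFinM -EFinB; congr _%:E.
    by rewrite -{2}(sqr_sqrtr (f0 x)); ring.
  over.
rewrite integralB//; last 2 first.
- rewrite (_ : (fun _ => _) = cst 1 \+ (EFin \o f)); last exact/funext.
  by apply: integrableD => //; exact: finite_measure_integrable_cst.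
- exact: integrableZl.
rewrite integralZl//; congr (_ - _).
under eq_integral do rewrite EFinD.
rewrite integralD//; last exact: finite_measure_integrable_cst.
by rewrite integral_cst// mul1e intf1 [X in X + _]nu1.
Qed.

Let ae_f_gt0 : {ae mu, forall x, (0 < f x)%R}.
Proof.
have mN : measurable [set x | (f x <= 0)%R].
  rewrite -[X in measurable X]setTI.
  have m0 : measurable_fun setT (fun x => (f x <= 0)%R).
    by apply: measurable_fun_ler => //; exact: measurable_cst.
  exact: (m0 measurableT [set true]).
exists [set x | (f x <= 0)%R]; split => //.
  rewrite muE//; apply: integral0_eq => x /= fx0.
  by congr _%:E; apply/eqP; rewrite eq_le fx0 f0.
by move=> x /= /negP; rewrite -leNgt.
Qed.

(** Integrating [ln f >= 2 - 2 / sqrt f] against [mu = f nu] gives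
    [2 - 2 * int (sqrt f) dnu], which is the squared Hellinger distance.  Unlike
    [t ln t], its integrand is nonnegative, so it may be restricted to any
    region of the space. *)
Lemma hellinger_le_kl_div :
  \int[nu]_x ((Num.sqrt (f x) - 1) ^+ 2)%:E <= kl_div mu nu.
Proof.
have munu := density_dominates meEf muE.
rewrite /kl_div; case: asboolP => // _.
rewrite hellinger_eq -int_pow.
rewrite (_ : 2 - _ = \int[mu]_x (2 - 2 * f x `^ (- 2^-1))%:E); last first.
  transitivity (\int[mu]_x (cst 2%:E x - 2%:E * (f x `^ (- 2^-1))%:E));
    last exact: eq_integral.
  rewrite integralB//; last 2 first.
  - exact: finite_measure_integrable_cst.
  - exact: integrableZl.
  by rewrite integralZl// integral_cst// [X in _ * X - _]mu1 mule1.
apply: ae_le_integral_minorant.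
- rewrite (_ : (fun _ => _) = cst 2 \- (fun x => 2%:E * (f x `^ (- 2^-1))%:E)).
    apply: integrableB => //; first exact: finite_measure_integrable_cst.
    exact: integrableZl.
  by apply/funext.
- apply: measurableT_comp; first exact: measurable_lne.
  exact: measurable_int (Radon_Nikodym_integrable _).
- have /(null_dominates_ae_eq measurableT munu) := density_ae_eq meEf muE.
  apply: filterS2 ae_f_gt0 => x fx0 /(_ I) ->.
  by rewrite lne_EFin// lee_fin ln_ge_inv_sqrt.
Qed.

End hellinger.

(** * Moments of sums of independent centered variables *)

Section moments.
Context (R : realType).

Lemma Rintegral_probability_cst d (T : measurableType d) (Q : probability T R)
    (a : R) :
  \int[Q]_x a = a.
Proof.
by rewrite Rintegral_cst// [X in fine X](@probability_setT _ _ _ Q) mulr1.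
Qed.

Section cubic.
Context d (T : measurableType d) (Q : probability T R).
Variables (W : T -> R) (C : R).
Hypotheses (mW : measurable_fun setT W) (WC : forall x, `|W x| <= C).

Lemma integrable_bounded_exprn k :
  Q.-integrable setT (EFin \o (fun x => W x ^+ k)).
Proof.
apply: (@bounded_integrable _ _ _ _ _ (C ^+ k)); first exact: measurable_funX.
by move=> x; rewrite normrX lerXn2r// nnegrE (le_trans _ (WC x)).
Qed.

Let integrableDE (f g : T -> R) : Q.-integrable setT (EFin \o f) ->
  Q.-integrable setT (EFin \o g) ->
  Q.-integrable setT (EFin \o (fun x => f x + g x)).
Proof.
move=> intf intg; rewrite -[EFin \o _]/((EFin \o f) \+ (EFin \o g))%E.
exact: integrableD.
Qed.

Let integrableZlE (f : T -> R) b : Q.-integrable setT (EFin \o f) ->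
  Q.-integrable setT (EFin \o (fun x => b * f x)).
Proof. by move=> intf; exact: (integrableZl measurableT b intf). Qed.

Lemma integrable_cubic a b c e : Q.-integrable setT
  (EFin \o (fun x => a + b * W x + c * W x ^+ 2 + e * W x ^+ 3)).
Proof.
have i0 : Q.-integrable setT (EFin \o (fun=> a)).
  exact: finite_measure_integrable_cst.
have j1 := integrableZlE b (integrable_bounded_exprn 1).
have j2 := integrableZlE c (integrable_bounded_exprn 2).
have j3 := integrableZlE e (integrable_bounded_exprn 3).
exact: (integrableDE (integrableDE (integrableDE i0 j1) j2) j3).
Qed.

Lemma Rintegral_cubic a b c e :
  \int[Q]_x (a + b * W x + c * W x ^+ 2 + e * W x ^+ 3) =
  a + b * \int[Q]_x W x + c * \int[Q]_x (W x ^+ 2) + e * \int[Q]_x (W x ^+ 3).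
Proof.
have i1 := integrable_bounded_exprn 1.
have i2 := integrable_bounded_exprn 2.
have i3 := integrable_bounded_exprn 3.
have i0 : Q.-integrable setT (EFin \o (fun=> a)).
  exact: finite_measure_integrable_cst.
have j1 := integrableZlE b i1.
have j2 := integrableZlE c i2.
have j3 := integrableZlE e i3.
rewrite RintegralD//; last exact: (integrableDE (integrableDE i0 j1) j2).
rewrite RintegralD//; last exact: integrableDE.
rewrite RintegralD// Rintegral_probability_cst.
by rewrite !RintegralZl.
Qed.

End cubic.

Section iid_sums.
Context d (T : measurableType d) (P : probability T R).

Lemma ge0_integral_power_lawS n (F : n.+1.-tuple T -> \bar R) :
  measurable_fun setT F -> (forall x, 0 <= F x)%E ->
  (\int[power_law P n.+1]_s F s =
   \int[P]_x \int[power_law P n]_t F (tuple_cons (x, t)))%E.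
Proof.
move=> mF F0; rewrite ge0_integral_distribution// fubini_tonelli1//.
  by apply: measurableT_comp => //; exact: measurable_tuple_cons.
by move=> z; exact: F0.
Qed.

Lemma Rintegral_power_lawS n (h : n.+1.-tuple T -> R) C :
  measurable_fun setT h -> (forall s, `|h s| <= C) ->
  \int[power_law P n.+1]_s h s =
  \int[P]_x \int[power_law P n]_t h (tuple_cons (x, t)).
Proof.
move=> mh hC.
have mhc : measurable_fun setT (h \o @tuple_cons _ T n).
  by apply: measurableT_comp => //; exact: measurable_tuple_cons.
have ihc : (P \x power_law P n)%E.-integrable setT
    (EFin \o (h \o @tuple_cons _ T n)).
  apply: (@bounded_integrable _ _ _
    (P \x power_law P n : probability _ _)%E _ C) => //.
  by move=> z; exact: hC.
rewrite /Rintegral/= integral_distribution//; last exact/measurable_EFinP.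
rewrite -integral12_prod_meas1//; congr fine; apply: eq_integral => x _.
rewrite /fubini_F fineK//.
apply: integrable_fin_num => //.
apply: (@bounded_integrable _ _ _ _ _ C) => [|t]; last exact: hC.
exact: (measurableT_comp mhc (measurable_pair1 x)).
Qed.

Variables (g : T -> R) (C : R).
Hypotheses (mg : measurable_fun setT g) (gC : forall x, `|g x| <= C).
Hypothesis g0 : \int[P]_x g x = 0.

Definition tuple_sum n (s : n.-tuple T) := \sum_(i < n) g (tnth s i).

Lemma measurable_tuple_sum n : measurable_fun setT (@tuple_sum n).
Proof.
by apply: measurable_sum => i; exact: measurableT_comp mg (measurable_tnth i).
Qed.

Lemma tuple_sum_bounded n (s : n.-tuple T) : `|tuple_sum s| <= n%:R * C.
Proof.
rewrite (le_trans (ler_norm_sum _ _ _))// mulr_natl.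
rewrite (le_trans (ler_sum _ (fun i _ => gC (tnth s i))))//.
by rewrite sumr_const card_ord.
Qed.

Lemma tuple_sum_cons n x (t : n.-tuple T) :
  tuple_sum (tuple_cons (x, t)) = g x + tuple_sum t.
Proof.
rewrite /tuple_sum big_ord_recl; congr (_ + _).
by apply: eq_bigr => i _; rewrite tnthS.
Qed.

(** The cross terms in the expansion of [(g x + S) ^ k], [k <= 3], all contain a
    first moment, so the second and third moments are additive.  The three
    powers are handled by a single induction step, for a general cubic
    polynomial without constant term. *)
Lemma moments_tuple_sum n : [/\ \int[power_law P n]_s tuple_sum s = 0,
  \int[power_law P n]_s (tuple_sum s ^+ 2) = n%:R * \int[P]_x (g x ^+ 2) &
  \int[power_law P n]_s (tuple_sum s ^+ 3) = n%:R * \int[P]_x (g x ^+ 3)].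
Proof.
elim: n => [|n [IH1 IH2 IH3]].
  by split; under eq_Rintegral do rewrite /tuple_sum big_ord0 ?expr0n/=;
    rewrite Rintegral_probability_cst ?mul0r.
have cubic (a b c : R) : \int[power_law P n.+1]_s
    (a * tuple_sum s + b * tuple_sum s ^+ 2 + c * tuple_sum s ^+ 3) =
  b * (n.+1%:R * \int[P]_x (g x ^+ 2)) + c * (n.+1%:R * \int[P]_x (g x ^+ 3)).
  have mS := @measurable_tuple_sum n.+1.
  rewrite (@Rintegral_power_lawS _ _ (`|a| * (n.+1%:R * C) +
     `|b| * (n.+1%:R * C) ^+ 2 + `|c| * (n.+1%:R * C) ^+ 3)); last 2 first.
  - by repeat (apply: measurable_funD || apply: measurable_funM ||
               apply: measurable_funX).
  - move=> s; have Ss := tuple_sum_bounded s.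
    rewrite (le_trans (ler_normD _ _))// lerD//.
      rewrite (le_trans (ler_normD _ _))// lerD// normrM ler_pM// normrX.
      by rewrite lerXn2r// nnegrE (le_trans _ Ss).
    rewrite normrM ler_pM// normrX.
    by rewrite lerXn2r// nnegrE (le_trans _ Ss).
  under eq_Rintegral => x _.
    under eq_Rintegral => t _.
      rewrite tuple_sum_cons.
      rewrite (_ : _ + _ + _ = (a * g x + b * g x ^+ 2 + c * g x ^+ 3) +
        (a + 2 * b * g x + 3 * c * g x ^+ 2) * tuple_sum t +
        (b + 3 * c * g x) * tuple_sum t ^+ 2 + c * tuple_sum t ^+ 3);
        last by ring.
      over.
    rewrite (Rintegral_cubic _ (@measurable_tuple_sum n)
                             (@tuple_sum_bounded n)).
    rewrite IH1 IH2 IH3.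
    set v := \int[P]_y _; set k := \int[P]_y _.
    rewrite (_ : _ + _ = (n%:R * (b * v + c * k)) +
       (a + 3 * n%:R * c * v) * g x + b * g x ^+ 2 + c * g x ^+ 3);
       last by ring.
    over.
  rewrite (Rintegral_cubic _ mg gC) g0 -natr1; ring.
split.
- by have := cubic 1 0 0; under eq_Rintegral do rewrite mul1r !mul0r !addr0;
    rewrite !mul0r addr0.
- by have := cubic 0 1 0;
    under eq_Rintegral do rewrite mul1r !mul0r add0r !addr0;
    rewrite !mul0r addr0 mul1r.
- by have := cubic 0 0 1; under eq_Rintegral do rewrite mul1r !mul0r !add0r;
    rewrite !mul0r add0r mul1r.
Qed.

End iid_sums.
End moments.

(** * The mean of a bounded likelihood ratio *)

Section mean_of_bounded_density.
Context (R : realType) d (T : measurableType d) (P : probability T R).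
Variables (r : T -> R) (M : R).
Hypotheses (mr : measurable_fun setT r) (r0 : forall x, 0 <= r x).
Hypotheses (rM : forall x, r x <= M) (r1 : \int[P]_x r x = 1).

Definition tuple_mean n (s : n.-tuple T) := n%:R^-1 * \sum_(i < n) r (tnth s i).

Lemma measurable_tuple_mean n : measurable_fun setT (@tuple_mean n).
Proof.
apply: measurable_funM => //; apply: measurable_sum => i.
exact: measurableT_comp mr (measurable_tnth i).
Qed.

Lemma tuple_mean_ge0 n (s : n.-tuple T) : 0 <= tuple_mean s.
Proof. by rewrite mulr_ge0// ?invr_ge0// sumr_ge0. Qed.

Lemma tuple_mean_le n (s : n.-tuple T) : (0 < n)%N -> tuple_mean s <= M.
Proof.
move=> n0; rewrite /tuple_mean ler_pdivrMl ?ltr0n//.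
rewrite (le_trans (ler_sum _ (fun i _ => rM (tnth s i))))//.
by rewrite sumr_const card_ord mulr_natl.
Qed.

(** Let [v] and [c] be the second and third central moments of [r].  The cubic
    minorant of [(sqrt t - 1) ^ 2] at the sample mean has expectation
    [v / (4 n) - c / (8 n ^ 2)], and [c <= M * v] since [r - 1 <= M].  For
    [M <= n] at least [v / (8 n)] remains. *)
Lemma variance_le_hellinger_mean n : (0 < n)%N -> M <= n%:R ->
  8^-1 * \int[P]_x ((r x - 1) ^+ 2) <=
  n%:R * \int[power_law P n]_s ((Num.sqrt (tuple_mean s) - 1) ^+ 2).
Proof.
move=> n0 Mn; have n0R : 0 < n%:R :> R by rewrite ltr0n.
pose g x := r x - 1.
have mg : measurable_fun setT g by exact: measurable_funB.
have gC x : `|g x| <= M + 1.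
  by rewrite (le_trans (ler_normB _ _))// normr1 lerD// ger0_norm.
have g0 : \int[P]_x g x = 0.
  rewrite RintegralB//; last 2 first.
  - apply: (@bounded_integrable _ _ _ _ _ M) => // x.
    by rewrite ger0_norm.
  - exact: finite_measure_integrable_cst.
  by rewrite r1 Rintegral_probability_cst subrr.
have [E1 E2 E3] := moments_tuple_sum mg gC g0 n.
have meanE (s : n.-tuple T) : tuple_mean s - 1 = n%:R^-1 * tuple_sum g s.
  rewrite /tuple_sum sumrB sumr_const card_ord mulrBr mulVf ?gt_eqF//.
have mS := @measurable_tuple_sum _ _ _ _ mg n.
have SC := @tuple_sum_bounded _ _ _ _ _ gC n.
(* the second factor of g ^ 3 = g * g ^ 2 is nonnegative and g <= M *)
have third : \int[P]_x (g x ^+ 3) <= M * \int[P]_x (g x ^+ 2).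
  rewrite -RintegralZl//; last exact: (integrable_bounded_exprn _ mg gC).
  apply: le_Rintegral => //; first exact: (integrable_bounded_exprn _ mg gC).
    exact: (integrableZl measurableT M (integrable_bounded_exprn _ mg gC 2)).
  move=> x _; rewrite exprS ler_wpM2r ?sqr_ge0// /g lerBlDr.
  by rewrite (le_trans (rM x))// lerDl.
have v0 : 0 <= \int[P]_x (g x ^+ 2).
  by apply: Rintegral_ge0 => x _; exact: sqr_ge0.
apply: (@le_trans _ _ (n%:R * \int[power_law P n]_s (0 + 0 * tuple_sum g s +
   (4^-1 * n%:R ^- 2) * tuple_sum g s ^+ 2 +
   (- (8^-1 * n%:R ^- 3)) * tuple_sum g s ^+ 3))).
  rewrite (Rintegral_cubic _ mS SC) E2 E3.
  move: third v0; rewrite /g.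
  set v := \int[P]_x ((r x - 1) ^+ 2).
  set k := \int[P]_x ((r x - 1) ^+ 3) => third v0.
  rewrite [leRHS](_ : _ = 4^-1 * v - (8^-1 * n%:R^-1) * k); last first.
    by field; rewrite gt_eqF.
  have : (8^-1 * n%:R^-1) * k <= 8^-1 * v.
    rewrite -mulrA ler_pM2l ?invr_gt0// ler_pdivrMl//.
    by rewrite (le_trans third)// ler_wpM2r.
  lra.
rewrite ler_pM2l//; apply: le_Rintegral => //.
- exact: (integrable_cubic _ mS SC).
- apply: (@bounded_integrable _ _ _ _ _ (M + 1)).
    apply: measurable_funX; apply: measurable_funB => //.
    exact: measurableT_comp (@measurable_sqrt R) (@measurable_tuple_mean n).
  move=> s; rewrite ger0_norm ?sqr_ge0//.
  have := tuple_mean_le s n0; have := tuple_mean_ge0 s; set t := tuple_mean s.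
  by move=> t0 tM; have := sqr_sqrtr t0; have := sqrtr_ge0 t; nra.
- move=> s _; rewrite mul0r !add0r.
  rewrite (le_trans _ (sqrB1_sqrt_ge (tuple_mean_ge0 s)))//.
  rewrite meanE; set S := tuple_sum g s.
  by rewrite le_eqVlt; apply/orP; left; apply/eqP; field; rewrite gt_eqF.
Qed.

End mean_of_bounded_density.

(** * Channels with a pointwise bounded likelihood ratio *)

Section bounded_channel.
Context (R : realType) dX dY (X : measurableType dX) (Y : measurableType dY).
Variables (P : probability X R) (nu : {finite_measure set Y -> \bar R}).
Variables (r : X * Y -> R) (B : Y -> R).
Variable mu : forall n, n.-tuple X -> {finite_measure set Y -> \bar R}.
Hypotheses (nu1 : nu setT = 1%E) (mr : measurable_fun setT r).
Hypotheses (r0 : forall z, 0 <= r z) (r1 : forall y, \int[P]_x r (x, y) = 1).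
Hypotheses (mB : measurable_fun setT B) (rB : forall x y, r (x, y) <= B y).
Hypothesis mu1 : forall n s, (0 < n)%N -> @mu n s setT = 1%E.
Hypothesis muE : forall n (s : n.-tuple X), (0 < n)%N ->
  forall A, measurable A ->
  mu s A = (\int[nu]_(y in A) (tuple_mean (fun x => r (x, y)) s)%:E)%E.
Local Open Scope ereal_scope.

Let mrl y : measurable_fun setT (fun x => r (x, y)).
Proof. exact: measurableT_comp mr (measurable_pair2 y). Qed.

Definition variance_at y := \int[P]_x ((r (x, y) - 1) ^+ 2)%:E.

Local Notation V := variance_at.

Let mr2 : measurable_fun setT (fun z : X * Y => ((r z - 1) ^+ 2)%:E).
Proof. by apply/measurable_EFinP/measurable_funX/measurable_funB. Qed.

Let mV : measurable_fun setT V.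
Proof.
by apply: (measurable_fun_fubini_tonelli_G _ mr2) => z; rewrite lee_fin sqr_ge0.
Qed.

Let V0 y : 0 <= V y.
Proof. by apply: integral_ge0 => x _; rewrite lee_fin sqr_ge0. Qed.

(** The truncation level grows with the sample size, exactly as fast as
    [variance_le_hellinger_mean] allows. *)
Definition bounded_at n := [set y | (B y <= n%:R)%R].

Let mbounded_at n : measurable (bounded_at n).
Proof.
rewrite -[X in measurable X]setTI.
have m0 : measurable_fun setT (fun y => (B y <= n%:R)%R).
  by apply: measurable_fun_ler => //; exact: measurable_cst.
exact: (m0 measurableT [set true]).
Qed.

Let h n (z : n.-tuple X * Y) :=
  ((Num.sqrt (tuple_mean (fun x => r (x, z.2)) z.1) - 1) ^+ 2)%R.

Let mmean n : measurable_fun setT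
  (fun z : n.-tuple X * Y => tuple_mean (fun x => r (x, z.2)) z.1).
Proof.
apply: measurable_funM => //; apply: measurable_sum => i.
apply: (measurableT_comp mr); apply: measurable_fun_pair => //.
exact: measurableT_comp (measurable_tnth i) _.
Qed.

Let mh n : measurable_fun setT (EFin \o @h n).
Proof.
apply/measurable_EFinP/measurable_funX/measurable_funB => //.
exact: measurableT_comp (@measurable_sqrt R) (@mmean n).
Qed.

Let h0 n z : 0 <= (@h n z)%:E. Proof. by rewrite lee_fin sqr_ge0. Qed.

(** Tonelli's theorem reduces the expected Hellinger distance to one mean of a
    bounded likelihood ratio for each output [y]. *)
Lemma truncated_chi2_le_kl_div n : (0 < n)%N ->
  (8^-1)%:E * \int[nu]_(y in bounded_at n) V y <=
  n%:R%:E * \int[power_law P n]_s kl_div (mu s) nu.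
Proof.
move=> n0.
apply: (@le_trans _ _
  (n%:R%:E * \int[power_law P n]_s \int[nu]_y (h (s, y))%:E)); last first.
  rewrite lee_wpmul2l//; apply: ge0_le_integral_nonmeasurable.
  - exact: (measurable_fun_fubini_tonelli_F _ (@mh n) (@h0 n)).
  - by move=> s; exact: integral_ge0.
  - move=> s; apply: hellinger_le_kl_div => //.
    + exact: measurableT_comp (@mmean n) (measurable_pair1 s).
    + by move=> y; exact: tuple_mean_ge0.
    + exact: muE.
    + exact: mu1.
pose F y := \int[power_law P n]_s (h (s, y))%:E.
have mF : measurable_fun setT F.
  exact: (measurable_fun_fubini_tonelli_G _ (@mh n) (@h0 n)).
have F0 y : 0 <= F y by exact: integral_ge0.
rewrite (fubini_tonelli _ (@mh n) (@h0 n)) -/F.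
rewrite -[leLHS]ge0_integralZl//; last exact: measurable_funTS.
rewrite -[leRHS]ge0_integralZl//; last by move=> y _; exact: F0.
apply: (@le_trans _ _ (\int[nu]_(y in bounded_at n)
    (n%:R%:E * F y))); last first.
  apply: ge0_subset_integral => //.
  - exact: emeasurable_funM.
  - by move=> y _; rewrite mule_ge0.
apply: ge0_le_integral => //.
- by move=> y _; rewrite mule_ge0// lee_fin invr_ge0.
- by apply: emeasurable_funM => //; exact: measurable_funTS.
- by apply: emeasurable_funM => //; exact: measurable_funTS.
move=> y /= yn.
have := @variance_le_hellinger_mean R _ X P _ (B y) (mrl y)
  (fun x => r0 (x, y)) (fun x => rB x y) (r1 y) n n0 yn.
rewrite -lee_fin !EFinM /Rintegral !fineK//.
- apply: integrable_fin_num => //.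
  apply: (@bounded_integrable _ _ _ _ _ (B y + 1)%R).
    have /measurable_EFinP mhR := @mh n.
    exact: (measurableT_comp mhR (measurable_pair2 y)).
  move=> s; rewrite /h/= ger0_norm ?sqr_ge0//.
  have := tuple_mean_le (fun x => rB x y) s n0.
  have := tuple_mean_ge0 (fun x => r0 (x, y)) s.
  set t := tuple_mean _ s => t0 tM.
  by have := sqr_sqrtr t0; have := sqrtr_ge0 t; nra.
- apply: integrable_fin_num => //.
  apply: (@bounded_integrable _ _ _ _ _ ((B y + 1) ^+ 2)%R).
    exact/measurable_funX/measurable_funB.
  move=> x; rewrite ger0_norm ?sqr_ge0//.
  by have := rB x y; have := r0 (x, y); nra.
Qed.

(** The sets [bounded_at n] increase to the whole output space, so by monotone
    convergence the truncated chi-square information grows to the full one. *)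
Lemma cvg_kl_div_pinfty : \int[nu]_y V y = +oo ->
  n%:R%:E * \int[power_law P n]_s kl_div (mu s) nu @[n --> \oo] --> +oo.
Proof.
move=> Voo.
have cvgV : \int[nu]_(y in bounded_at n) V y @[n --> \oo] --> +oo.
  rewrite -Voo -[X in _ --> \int[nu]_(y in X) _](_ :
    \bigcup_n bounded_at n = setT).
    apply: ge0_nondecreasing_set_cvg_integral => //.
    - move=> n m nm; apply/subsetPset => y /= /le_trans; apply.
      by rewrite ler_nat.
    - by move=> n; exact: measurable_funTS.
  apply/seteqP; split => // y _; exists (Num.truncn (B y)).+1 => //=.
  exact/ltW/truncnS_gt.
have : (8^-1)%:E * \int[nu]_(y in bounded_at n) V y @[n --> \oo] --> +oo.
  by rewrite -[X in _ --> X](@gt0_muley R (8^-1)%:E)//; exact: cvgeZl.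
apply: gee_cvgy; exists 1%N => // n /= n0.
exact: truncated_chi2_le_kl_div.
Qed.

End bounded_channel.

(** * Translations of the Gaussian law *)

Section lebesgue_translation.
Context (R : realType).
Local Open Scope ereal_scope.
Local Notation leb := (@lebesgue_measure R).

Let shift (c x : measurableTypeR R) : measurableTypeR R := (c + x)%R.

Let measurable_shift c : measurable_fun setT (shift c).
Proof. exact: measurable_funD. Qed.

Let lebesgue_shift c A : measurable A ->
  leb A = pushforward leb (shift c) A.
Proof.
pose shift_mfun : {mfun measurableTypeR R >-> measurableTypeR R} :=
  HB.pack (shift c) (isMeasurableFun.Build _ _ _ _ _ (measurable_shift c)).
apply: (@lebesgue_measure_unique R (pushforward leb shift_mfun)).
move=> _ [[a b] _ <-].
transitivity (leb `](a - c)%R, (b - c)%R]%classic); last first.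
  congr (leb _); apply/seteqP; split => x;
  by rewrite /= !in_itv/= /shift; lra.
rewrite !lebesgue_measure_itv/= !lte_fin ltrD2r.
by case: ifPn => // _; rewrite -!EFinB; congr _%:E; ring.
Qed.

(** As [F] is only measurable, no antiderivative is available: the translate of
    the Lebesgue measure agrees with it on intervals, hence everywhere. *)
Lemma integral_lebesgue_shift c (F : measurableTypeR R -> \bar R) :
  measurable_fun setT F -> (forall x, 0 <= F x) ->
  \int[leb]_x F (c + x)%R = \int[leb]_x F x.
Proof.
move=> mF F0.
rewrite [RHS](@eq_measure_integral _ _ _ _ (pushforward leb (shift c))).
  by rewrite (ge0_integral_pushforward (measurable_shift c)).
by move=> A mA _; exact: lebesgue_shift.
Qed.

End lebesgue_translation.

Section gaussian_shift.
Context (R : realType) (sigma : R).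
Hypothesis sigma_gt0 : 0 < sigma.

(** The likelihood ratio of [N(s, sigma^2 I)] to [N(0, sigma^2 I)] at [y].  With
    the centered Gaussian law as reference measure, instead of the Lebesgue
    measure of R^d, everything is a probability defined by recursion on [d]. *)
Definition gauss_ratio d (s y : d.-tuple R) : R :=
  expR (\sum_(i < d) (tnth s i * tnth y i - tnth s i ^+ 2 / 2) / sigma ^+ 2).

Let ratio1 (a x : R) := expR ((a * x - a ^+ 2 / 2) / sigma ^+ 2).

Let sigma_neq0 : sigma != 0. Proof. by rewrite gt_eqF. Qed.

Let normal_pdf_shift (a x : R) :
  normal_pdf 0 sigma (x - a) = normal_pdf 0 sigma x * ratio1 a x.
Proof.
rewrite normal_pdfE// -mulrA -expRD; congr (_ * expR _).
by field.
Qed.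

Let integral_normal_shift a (F : R -> \bar R) :
  measurable_fun setT F -> (forall x, 0 <= F x)%E ->
  (\int[normal_law 0 sigma]_x F (a + x)%R =
   \int[normal_law 0 sigma]_x (F x * (ratio1 a x)%:E))%E.
Proof.
move=> mF F0.
have mpdf : measurable_fun setT
    (fun x : measurableTypeR R => (normal_pdf 0 sigma x)%:E).
  apply/measurable_EFinP; exact: (measurable_normal_pdf 0 sigma).
have mratio : measurable_fun setT (ratio1 a).
  apply: measurableT_comp => //; apply: measurable_funM => //.
  by apply: measurable_funB => //; apply: measurable_funM.
have normalE G : measurable_fun setT G -> (forall x, 0 <= G x)%E ->
    (\int[normal_law 0 sigma]_x G x =
     \int[lebesgue_measure]_x (G x * (normal_pdf 0 sigma x)%:E))%E.
  move=> mG G0; rewrite ge0_integral_distribution//.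
  exact: (@ge0_integral_density _ _ _ (normal_prob 0 sigma) lebesgue_measure _
    mpdf (fun _ _ => erefl)).
have mFratio : measurable_fun setT (fun x => F x * (ratio1 a x)%:E)%E.
  by apply: emeasurable_funM => //; exact/measurable_EFinP.
have Fratio0 x : (0 <= F x * (ratio1 a x)%:E)%E.
  by rewrite mule_ge0// lee_fin expR_ge0.
rewrite !normalE//; last first.
  by apply: measurableT_comp => //; exact: measurable_funD.
pose G (x : measurableTypeR R) := (F x * (normal_pdf 0 sigma (x - a))%:E)%E.
transitivity (\int[lebesgue_measure]_x G (a + x)%R)%E.
  by apply: eq_integral => x _; rewrite /G (addrC a) addrK.
rewrite integral_lebesgue_shift.
- apply: eq_integral => x _.
  by rewrite /G normal_pdf_shift -muleA -EFinM [(ratio1 _ _ * _)%R]mulrC.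
- apply: emeasurable_funM => //; apply/measurable_EFinP.
  apply: (measurableT_comp (measurable_normal_pdf 0 sigma)).
  exact: measurable_funB.
- by move=> x; rewrite mule_ge0// lee_fin normal_pdf_ge0.
Qed.

Lemma gauss_ratio_cons d (a x : R) (s y : d.-tuple R) :
  gauss_ratio (tuple_cons (a, s)) (tuple_cons (x, y)) =
  ratio1 a x * gauss_ratio s y.
Proof.
rewrite /gauss_ratio big_ord_recl expRD; congr (_ * expR _).
by apply: eq_bigr => i _; rewrite !tnthS.
Qed.

Lemma addt_cons d (a x : R) (s y : d.-tuple R) :
  addt (tuple_cons (a, s)) (tuple_cons (x, y)) =
  tuple_cons ((a + x)%R, addt s y).
Proof.
apply: eq_from_tnth => i; rewrite tnth_mktuple.
by case: (unliftP ord0 i) => [j|] ->; rewrite ?tnthS ?tnth_mktuple.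
Qed.

Lemma measurable_gauss_ratio d : measurable_fun setT
  (fun z : d.-tuple R * d.-tuple R => gauss_ratio z.1 z.2).
Proof.
apply: measurableT_comp => //; apply: measurable_sum => i.
have m1 : measurable_fun setT (fun z : d.-tuple R * d.-tuple R => tnth z.1 i).
  exact: measurableT_comp (measurable_tnth i) _.
have m2 : measurable_fun setT (fun z : d.-tuple R * d.-tuple R => tnth z.2 i).
  exact: measurableT_comp (measurable_tnth i) _.
apply: measurable_funM => //; apply: measurable_funB.
  exact: measurable_funM.
by apply: measurable_funM => //; exact: measurable_funX.
Qed.

(** Cameron-Martin formula, by induction on the dimension: the case of one
    coordinate is a translation under the Lebesgue integral, and the likelihood
    ratio is a product over the coordinates. *)
Lemma integral_gaussian_shift d (s : d.-tuple R) (F : d.-tuple R -> \bar R) :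
  measurable_fun setT F -> (forall y, 0 <= F y)%E ->
  (\int[gaussian d sigma]_z F (addt s z) =
   \int[gaussian d sigma]_y (F y * (gauss_ratio s y)%:E))%E.
Proof.
elim: d s F => [|d IH] s F mF F0.
  apply: eq_integral => z _; rewrite /gauss_ratio big_ord0 expR0 mule1.
  by congr F; rewrite tuple0 [RHS]tuple0.
have mratio n (u : n.-tuple R) : measurable_fun setT (gauss_ratio u).
  exact: (measurableT_comp (@measurable_gauss_ratio _) (measurable_pair1 u)).
have madd n (u : n.-tuple R) : measurable_fun setT (addt u).
  exact: (measurableT_comp (@measurable_addt_pair _ _) (measurable_pair1 u)).
have mFratio : measurable_fun setT (fun y => F y * (gauss_ratio s y)%:E)%E.
  apply: emeasurable_funM => //; apply/measurable_EFinP; exact: mratio.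
have Fratio0 y : (0 <= F y * (gauss_ratio s y)%:E)%E.
  by rewrite mule_ge0// lee_fin expR_ge0.
have mFadd : measurable_fun setT (fun z => F (addt s z)).
  exact: (measurableT_comp mF (madd _ s)).
rewrite !ge0_integral_power_lawS//.
have [a [u sE]] : exists a u, s = tuple_cons (a, u).
  by exists (thead s), [tuple of behead s]; exact: tuple_eta.
rewrite {}sE {s mFadd mFratio Fratio0}.
pose H x := (\int[gaussian d sigma]_t
  (F (tuple_cons (x, t)) * (gauss_ratio u t)%:E))%E.
have mFcons x : measurable_fun setT (fun t => F (tuple_cons (x, t))).
  apply: (measurableT_comp mF).
  exact: (measurableT_comp (@measurable_tuple_cons _ _ _) (measurable_pair1 x)).
transitivity (\int[normal_law 0 sigma]_x H (a + x)%R)%E.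
  apply: eq_integral => x _.
  under eq_integral do rewrite addt_cons.
  exact: (IH u (fun t => F (tuple_cons (a + x, t))) (mFcons _) (fun _ => F0 _)).
rewrite integral_normal_shift.
- apply: eq_integral => x _; rewrite -ge0_integralZr//.
  + by apply: eq_integral => t _; rewrite gauss_ratio_cons mulrC EFinM muleA.
  + apply: emeasurable_funM => //; apply/measurable_EFinP; exact: mratio.
  + by move=> t _; rewrite mule_ge0// lee_fin expR_ge0.
  + by rewrite lee_fin expR_ge0.
- apply: (measurable_fun_fubini_tonelli_F
    (fun z : R * d.-tuple R => F (tuple_cons z) * (gauss_ratio u z.2)%:E)%E).
    apply: emeasurable_funM.
      exact: (measurableT_comp mF (@measurable_tuple_cons _ _ _)).
    by apply/measurable_EFinP; exact: (measurableT_comp (mratio _ u)).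
  by move=> z; rewrite mule_ge0// lee_fin expR_ge0.
- by move=> x; apply: integral_ge0 => t _; rewrite mule_ge0// lee_fin expR_ge0.
Qed.

End gaussian_shift.

(** * Convolutions with the Gaussian law *)

Section empirical_integral.
Context d (T : measurableType d) (R : realType).
Local Open Scope ereal_scope.

Lemma integral_empirical n (s : n.-tuple T) (f : T -> \bar R) :
  measurable_fun setT f -> (forall x, 0 <= f x) ->
  \int[empirical R s]_x f x = (n%:R^-1)%:E * \sum_(i < n) f (tnth s i).
Proof.
move=> mf f0.
rewrite (@eq_measure_integral _ _ _ _
  (mscale ((n%:R^-1 : R)%:nng)%R (msum (fun k => \d_(nth point s k)) n))).
  rewrite ge0_integral_mscale// ge0_integral_measure_sum//; congr (_ * _).
  apply: eq_bigr => i _; rewrite integral_dirac// diracT mul1e.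
  by rewrite (tnth_nth point).
move=> A _ _; rewrite /mscale /msum /= /empirical; congr (_ * _).
by apply: eq_bigr => i _; rewrite (tnth_nth point).
Qed.

Lemma empirical_setT n (s : n.-tuple T) : (0 < n)%N -> empirical R s setT = 1.
Proof.
move=> n0; rewrite /empirical (eq_bigr (fun=> 1)); last first.
  by move=> i _; rewrite diracT.
by rewrite sumEFin sumr_const card_ord -EFinM mulVf// pnatr_eq0 -lt0n.
Qed.

End empirical_integral.

Section gaussian_convolution.
Context (R : realType) (sigma : R) (d : nat).
Hypothesis sigma_gt0 : 0 < sigma.
Local Notation G := (gaussian d sigma).
Local Open Scope ereal_scope.

Definition input_output (z : d.-tuple R * d.-tuple R) := (z.1, addt z.1 z.2).

Lemma measurable_preimage_input_output A :
  measurable A -> measurable (input_output @^-1` A).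
Proof.
have mio : measurable_fun setT input_output.
  by apply: measurable_fun_pair => //; exact: measurable_addt_pair.
by move=> mA; rewrite -[X in measurable X]setTI; exact: mio.
Qed.

(** The left side is the joint law of input and output when the input has
    law [mu]. *)
Lemma product_gaussian_shift (mu : {finite_measure set (d.-tuple R) -> \bar R})
    (A : set (d.-tuple R * d.-tuple R)) : measurable A ->
  (mu \x G) (input_output @^-1` A) =
  \int[mu]_s \int[G]_y ((\1_A (s, y))%:E * (gauss_ratio sigma s y)%:E).
Proof.
move=> mA; have mtA := measurable_preimage_input_output mA.
rewrite -(setIT (_ @^-1` _)) -integral_indic// fubini_tonelli1//; last first.
  by apply/measurable_EFinP; exact: measurable_indic.
apply: eq_integral => s _; rewrite -integral_gaussian_shift//.
apply/measurable_EFinP.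
exact: (measurableT_comp (measurable_indic mA) (measurable_pair1 s)).
Qed.

Lemma convolution_gaussianE
    (mu : {finite_measure set (d.-tuple R) -> \bar R}) A :
  measurable A ->
  convolution mu G A = \int[G]_(y in A) \int[mu]_s (gauss_ratio sigma s y)%:E.
Proof.
move=> mA.
have mk := @measurable_gauss_ratio R sigma d.
rewrite /convolution /pushforward.
have mA2 : measurable ((snd : d.-tuple R * d.-tuple R -> _) @^-1` A).
  rewrite -[X in measurable X]setTI.
  exact: (@measurable_snd _ _ _ _ measurableT A mA).
rewrite -[LHS]/((mu \x G) (input_output @^-1` (snd @^-1` A))).
rewrite product_gaussian_shift// (fubini_tonelli
  (fun z => (\1_(snd @^-1` A) z)%:E * (gauss_ratio sigma z.1 z.2)%:E));
  last 2 first.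
- apply: emeasurable_funM; apply/measurable_EFinP; last exact: mk.
  exact: (measurable_indic mA2).
- by move=> z; rewrite mule_ge0// lee_fin ?expR_ge0.
rewrite [RHS]integral_mkcond epatch_indic; apply: eq_integral => y _ /=.
rewrite muleC -ge0_integralZl//.
- by apply/measurable_EFinP; exact: (measurableT_comp mk (measurable_pair2 y)).
- by move=> s _; rewrite lee_fin expR_ge0.
Qed.

End gaussian_convolution.

(** * The Gaussian channel *)

Lemma chi2_div_density d (T : measurableType d) (R : realType)
    (mu nu : {finite_measure set T -> \bar R}) (f : T -> R) :
  measurable_fun setT f ->
  (forall A, measurable A -> mu A = (\int[nu]_(x in A) (f x)%:E)%E) ->
  chi2_div mu nu = (\int[nu]_x ((f x - 1) ^+ 2)%:E)%E.
Proof.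
move=> mf muE.
have mEf : measurable_fun setT (EFin \o f) by exact/measurable_EFinP.
have munu := density_dominates mEf muE.
rewrite /chi2_div; case: asboolP => // _.
apply: ae_eq_integral => //.
- have mD : measurable_fun setT (fun x => density mu nu x - 1)%E.
    apply: emeasurable_funB => //.
    exact: measurable_int (Radon_Nikodym_integrable _).
  rewrite (_ : (fun x => _) =
    fun x => (density mu nu x - 1) * (density mu nu x - 1))%E.
    exact: emeasurable_funM.
  by apply/funext => x; rewrite expe2.
- by apply/measurable_EFinP/measurable_funX/measurable_funB.
- by apply: filterS (density_ae_eq mEf muE) => x + _ => /(_ I) ->.
Qed.

Section gaussian_channel.
Context (R : realType) (sigma : R) (d : nat).
Hypothesis sigma_gt0 : 0 < sigma.
Variable P : probability (d.-tuple R) R.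
Local Notation G := (gaussian d sigma).
Local Notation k := (@gauss_ratio R sigma d).
Local Notation nu := (convolution P G).

(** The maximum over [s] of [gauss_ratio sigma s y], attained at [s = y]. *)
Definition gauss_bound (y : d.-tuple R) : R :=
  expR (\sum_(i < d) (tnth y i ^+ 2 / 2) / sigma ^+ 2).

Lemma gauss_ratio_le s y : k s y <= gauss_bound y.
Proof.
rewrite ler_expR; apply: ler_sum => i _.
rewrite ler_pM2r ?invr_gt0 ?exprn_gt0//.
by have := sqr_ge0 (tnth s i - tnth y i); nra.
Qed.

Let mkl y : measurable_fun setT (k ^~ y).
Proof.
exact: (measurableT_comp (@measurable_gauss_ratio _ sigma d)
  (measurable_pair2 y)).
Qed.

Let mkE : measurable_fun setT
  (fun z : d.-tuple R * d.-tuple R => (k z.1 z.2)%:E).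
Proof. by apply/measurable_EFinP; exact: measurable_gauss_ratio. Qed.

Let integrable_ratio y : P.-integrable setT (EFin \o (k ^~ y)).
Proof.
apply: (@bounded_integrable _ _ _ _ _ (gauss_bound y)) => // s.
by rewrite ger0_norm ?expR_ge0 ?gauss_ratio_le.
Qed.

(** The density of the output law [P * N_sigma] with respect to [N_sigma]. *)
Definition output_ratio y := \int[P]_s k s y.

Let output_ratioE y : (\int[P]_s (k s y)%:E = (output_ratio y)%:E)%E.
Proof.
rewrite /output_ratio /Rintegral fineK//; apply: integrable_fin_num => //.
exact: integrable_ratio.
Qed.

Let output_ratio_gt0 y : 0 < output_ratio y.
Proof.
rewrite lt0r Rintegral_ge0 ?andbT; last by move=> s _; exact: expR_ge0.
apply/eqP => q0; have : (\int[P]_s `|(k s y)%:E| = 0)%E.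
  under eq_integral do rewrite gee0_abs ?lee_fin ?expR_ge0//.
  by rewrite output_ratioE q0.
move/ae_eq_integral_abs => /(_ measurableT) -[|N [mN N0 kN]].
  exact/measurable_EFinP.
(* k never vanishes, so the null set N off which k s y = 0 is everything *)
have NT : N = setT.
  apply/seteqP; split => // s _; apply: kN => /= /(_ I) [].
  by apply/eqP; rewrite gt_eqF// expR_gt0.
have := @probability_setT _ _ _ P; rewrite -NT N0 => -[] /eqP.
by rewrite eq_sym oner_eq0.
Qed.

Let measurable_output_ratio : measurable_fun setT output_ratio.
Proof.
apply/measurable_EFinP.
rewrite (_ : _ \o _ = fubini_G P
  (fun z : d.-tuple R * d.-tuple R => (k z.1 z.2)%:E)).
  by apply: measurable_fun_fubini_tonelli_G => // z; rewrite lee_fin expR_ge0.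
by apply/funext => y; rewrite /fubini_G/= output_ratioE.
Qed.

Let nuE A : measurable A -> (nu A = \int[G]_(y in A) (output_ratio y)%:E)%E.
Proof.
by move=> mA; rewrite convolution_gaussianE//; apply: eq_integral => y _.
Qed.

Definition channel_density (z : d.-tuple R * d.-tuple R) :=
  k z.1 z.2 / output_ratio z.2.

Let measurable_output_ratioV :
  measurable_fun setT (fun y => (output_ratio y)^-1).
Proof.
rewrite (_ : (fun _ => _) = (fun y => output_ratio y `^ (-1))).
  exact: measurableT_comp (measurable_powR _) measurable_output_ratio.
by apply/funext => y; rewrite powR_inv1// ltW.
Qed.

Lemma measurable_channel_density : measurable_fun setT channel_density.
Proof.
apply: measurable_funM; first exact: measurable_gauss_ratio.
exact: measurableT_comp measurable_output_ratioV _.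
Qed.

Lemma channel_density_ge0 z : 0 <= channel_density z.
Proof. by rewrite divr_ge0 ?expR_ge0// ltW. Qed.

Lemma integral_channel_density y : \int[P]_s channel_density (s, y) = 1.
Proof.
transitivity (\int[P]_s (k s y * (output_ratio y)^-1)) => //.
rewrite (@RintegralZr _ _ _ P setT (k ^~ y) _ measurableT (integrable_ratio y)).
by rewrite -/(output_ratio y) divff// gt_eqF.
Qed.

Definition channel_bound y := gauss_bound y / output_ratio y.

Lemma measurable_channel_bound : measurable_fun setT channel_bound.
Proof.
apply: measurable_funM => //; apply: measurableT_comp => //.
apply: measurable_sum => i; apply: measurable_funM => //.
by apply: measurable_funM => //; apply: measurable_funX; exact: measurable_tnth.
Qed.

Lemma channel_density_le s y : channel_density (s, y) <= channel_bound y.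
Proof. by rewrite ler_pM2r ?invr_gt0// gauss_ratio_le. Qed.

Lemma convolution_setT : nu setT = 1%E.
Proof.
rewrite /convolution /pushforward preimage_setT.
exact: (@probability_setT _ _ _ (P \x G : probability _ _)%E).
Qed.

Lemma convolution_empirical_setT n (s : n.-tuple (d.-tuple R)) : (0 < n)%N ->
  convolution (empirical R s) G setT = 1%E.
Proof.
move=> n0; rewrite /convolution /pushforward preimage_setT -setXTT.
rewrite product_measure1E//.
transitivity (1 * 1 : \bar R)%E; last by rewrite mule1.
by congr (_ * _)%E; [exact: empirical_setT|exact: probability_setT].
Qed.

Lemma convolution_empiricalE n (s : n.-tuple (d.-tuple R)) A : measurable A ->
  (convolution (empirical R s) G A =
   \int[nu]_(y in A) (tuple_mean (fun x => channel_density (x, y)) s)%:E)%E.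
Proof.
move=> mA; rewrite convolution_gaussianE//.
have mq : measurable_fun setT (EFin \o output_ratio) by exact/measurable_EFinP.
rewrite (ge0_integral_density mq nuE)//.
- apply: eq_integral => y _; rewrite integral_empirical//.
  + rewrite sumEFin -!EFinM; congr _%:E.
    rewrite /tuple_mean -mulrA; congr (_ * _).
    rewrite mulr_suml; apply: eq_bigr => i _.
    by rewrite /channel_density divfK// gt_eqF.
  + exact/measurable_EFinP.
  + by move=> x; rewrite lee_fin expR_ge0.
- apply/measurable_EFinP/measurable_funTS/measurable_funM => //.
  apply: measurable_sum => i.
  exact: (measurableT_comp measurable_channel_density (measurable_pair1 _)).
- move=> y; rewrite lee_fin; apply: tuple_mean_ge0 => x.
  exact: channel_density_ge0.
Qed.

(** The same function [channel_density] that gives the smoothed empirical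
    measures is the density of the joint law of input and output with respect
    to the product of its marginals. *)
Lemma joint_density (A : set (d.-tuple R * d.-tuple R)) : measurable A ->
  ((P \x G) (@input_output R d @^-1` A) =
   \int[P \x nu]_(z in A) (channel_density z)%:E)%E.
Proof.
move=> mA; rewrite product_gaussian_shift// [RHS]integral_mkcond epatch_indic.
have mq : measurable_fun setT (EFin \o output_ratio) by exact/measurable_EFinP.
have mf : measurable_fun setT
    ((EFin \o channel_density) \* (EFin \o \1_A))%E.
  apply: emeasurable_funM; apply/measurable_EFinP.
    exact: measurable_channel_density.
  exact: measurable_indic.
have f0 z : (0 <= ((EFin \o channel_density) \* (EFin \o \1_A)) z)%E.
  by apply: mule_ge0; rewrite lee_fin//; exact: channel_density_ge0.
rewrite fubini_tonelli1//; apply: eq_integral => s _; rewrite /fubini_F.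
rewrite (ge0_integral_density mq nuE)//.
- apply: eq_integral => y _ /=; rewrite -!EFinM; congr _%:E.
  by rewrite mulrAC /channel_density divfK ?gt_eqF// mulrC.
- exact: (measurableT_comp mf (measurable_pair1 s)).
- by move=> y; exact: f0.
Qed.

End gaussian_channel.

(** * Divergence of the expected relative entropy *)

Theorem proposition7 (R : realType) (d : nat) (hd : (1 <= d)%N)
    (sigma : R) (hsigma : 0 < sigma) (P : probability (d.-tuple R) R)
    (dO : measure_display) (Omega : measurableType dO)
    (Pr : probability Omega R) (S Z Y : {RV Pr >-> d.-tuple R})
    (hS : has_law S P) (hZ : has_law Z (gaussian d sigma))
    (hSZ : independent_rv S Z) (hY : forall w, Y w = addt (S w) (Z w))
    (hI : chi2_info S Y = +oo%E) :
  (n%:R%:E * \int[power_law P n]_s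
     kl_div (convolution (empirical R s) (gaussian d sigma))
            (convolution P (gaussian d sigma)))%E @[n --> \oo] --> +oo%E.
Proof.
set G := gaussian d sigma; pose r := channel_density sigma P.
have mr := measurable_channel_density hsigma P.
have jointSZ A : measurable A -> distribution Pr (pair_rv S Z) A = (P \x G)%E A.
  move=> mA; apply/esym; apply: product_measure_unique => // B C mB mC.
  by rewrite -hS// -hZ//; exact: hSZ.
have jointSY A : measurable A -> distribution Pr (pair_rv S Y) A =
    (P \x G)%E (@input_output R d @^-1` A).
  move=> mA; rewrite -jointSZ; last exact: measurable_preimage_input_output.
  rewrite /distribution /pushforward; congr (Pr _).
  by apply/seteqP; split => w /=; rewrite /pair_rv hY.
have lawY A : measurable A -> distribution Pr Y A = convolution P G A.
  move=> mA.
  have mA2 : measurable ((snd : d.-tuple R * d.-tuple R -> _) @^-1` A).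
    rewrite -[X in measurable X]setTI.
    exact: (@measurable_snd _ _ _ _ measurableT A mA).
  exact: (jointSY _ mA2).
have prodE A : measurable A ->
    (P \x convolution P G)%E A = (distribution Pr S \x distribution Pr Y)%E A.
  move=> mA; apply: product_measure_unique => // B C mB mC.
  transitivity (distribution Pr S B * distribution Pr Y C)%E.
    exact: product_measure1E.
  by rewrite hS// lawY.
have chi2oo :
    (\int[convolution P G]_y \int[P]_s ((r (s, y) - 1) ^+ 2)%:E = +oo)%E.
  rewrite -hI /chi2_info (@chi2_div_density _ _ _ _ _ r)//.
    rewrite (@eq_measure_integral _ _ _ _ (P \x convolution P G)%E); last first.
      by move=> A mA _; exact: (esym (prodE A mA)).
    rewrite (fubini_tonelli2 (fun z => ((r z - 1) ^+ 2)%:E))//.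
      by apply/measurable_EFinP/measurable_funX/measurable_funB.
    by move=> z; rewrite lee_fin sqr_ge0.
  move=> A mA; transitivity ((P \x G)%E (@input_output R d @^-1` A)).
    exact: jointSY.
  rewrite joint_density//.
  by apply: eq_measure_integral => B mB _; exact: prodE.
apply: (@cvg_kl_div_pinfty _ _ _ _ _ P (convolution P G) r
  (channel_bound sigma P)
  (fun n s => convolution (empirical R s) G)) => //.
- exact: convolution_setT.
- exact: channel_density_ge0.
- exact: integral_channel_density.
- exact: measurable_channel_bound.
- exact: channel_density_le.
- by move=> n s n0; exact: convolution_empirical_setT.
- by move=> n s n0 A mA; exact: convolution_empiricalE.
Qed.
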